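(* Let $s,t\ge1$ and $D\ge3$ be integers and let $\ell=2\lceil\log s/\log(D-1)\rceil+3$. Let $\mathcal G=\{G_1,\dots,G_t\}$ be an $s$-joined graph family on $n$ vertices. Let $\mathcal H$ be a $[t]$-edge-colored subdivision of $K_D$ in which every path between two branch vertices has length at least $\ell$, and with $\Delta^{mon}(\mathcal H)\le D$. If $|V(\mathcal H)|\le n-6sD$, then $\mathcal G$ contains $\mathcal H$.
   Context: A graph family $\mathcal G=\{G_1,\dots,G_t\}$ is a collection of $t$ simple graphs on a common finite vertex set $V$, $n=|V|$. It is $s$-joined if for all $X\subseteq V\times[t]$ and $Y\subseteq V$ with $|X|\ge s$ and $|Y|\ge s$ there exist $(v,i)\in X$ and $y\in Y$ with $vy\in E(G_i)$. A $[t]$-edge-colored graph $\mathcal H$ is a simple graph each of whose edges is assigned a color in $[t]$; $\deg_{H_i}(h)$ denotes the number of edges of color $i$ at $h$, and $\Delta^{mon}(\mathcal H)=\max_{i\in[t]}\max_{h\in V(\mathcal H)}\deg_{H_i}(h)$. $\mathcal G$ contains $\mathcal H$ if there is an injective map $\phi:V(\mathcal H)\to V$ with $\phi(u)\phi(v)\in E(G_i)$ for every edge $uv$ of color $i$. A subdivision of $K_m$ is obtained from $K_m$ by replacing each edge by a path, these paths internally vertex-disjoint and disjoint from the original vertices except at their ends; the original vertices are the branch vertices. *)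

(* Defs.v *)
From mathcomp Require Import all_boot.
Set Implicit Arguments. Unset Strict Implicit. Unset Printing Implicit Defensive.

Definition simple_graph (V : finType) (e : rel V) : Prop :=
  symmetric e /\ irreflexive e.

Definition graph_family (V : finType) (t : nat) (G : 'I_t -> rel V) : Prop :=
  forall i, simple_graph (G i).

Definition s_joined (V : finType) (t : nat) (G : 'I_t -> rel V) (s : nat) : Prop :=
  forall (X : {set V * 'I_t}) (Y : {set V}),
    s <= #|X| -> s <= #|Y| ->
    exists v i y, [/\ (v, i) \in X, y \in Y & G i v y].

Definition edge_colored (W : finType) (t : nat) (e : rel W) (c : W -> W -> 'I_t)
  : Prop :=
  simple_graph e /\ (forall u v, e u v -> c u v = c v u).

Definition mon_deg (W : finType) (t : nat) (e : rel W) (c : W -> W -> 'I_t)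
  (i : 'I_t) (h : W) : nat :=
  #|[set u | e h u & c h u == i]|.

Definition max_mon_deg_le (W : finType) (t : nat) (e : rel W)
  (c : W -> W -> 'I_t) (D : nat) : Prop :=
  forall i h, mon_deg e c i h <= D.

Definition contains (V W : finType) (t : nat) (G : 'I_t -> rel V)
  (e : rel W) (c : W -> W -> 'I_t) : Prop :=
  exists phi : W -> V, injective phi /\
    forall u v, e u v -> G (c u v) (phi u) (phi v).

Definition branch_path (W : finType) (x y : W) (p : seq W) : seq W :=
  x :: rcons p y.

Definition subdivision_KD (W : finType) (e : rel W) (D l : nat) : Prop :=
  exists (b : 'I_D -> W) (p : 'I_D -> 'I_D -> seq W),
  [/\ injective b,
      (forall i j : 'I_D, i < j ->
         [/\ path e (b i) (rcons (p i j) (b j)),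
             uniq (branch_path (b i) (b j) (p i j)),
             l <= (size (p i j)).+1 &
             forall x, x \in p i j -> forall k, x != b k]),
      (forall i j i' j' : 'I_D, i < j -> i' < j' -> (i, j) != (i', j') ->
         forall x, x \in p i j -> x \notin p i' j'),
      (forall x : W, (exists k, x = b k) \/
                     (exists i j : 'I_D, i < j /\ x \in p i j)) &
      (forall u v : W, e u v -> exists i j : 'I_D, i < j /\
         let s := branch_path (b i) (b j) (p i j) in
         ((u, v) \in zip s (behead s)) || ((v, u) \in zip s (behead s)))].

(* Main.v *)
Require Import Defs.
From mathcomp Require Import all_boot.
From mathcomp Require Import zify.

(* A Friedman-Pippenger embedding with roll-back. Call a pair (vertex, colour) a
   port. A set U of used vertices together with a demand f on ports is extendable
   if every set X of at most 2s ports has at least f(X) neighbours outside U. In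
   an s-joined family, sets for which this is an equality ("tight" sets) have
   fewer than s ports and are closed under union, which makes it possible to use
   up a new vertex, attached to any port of positive demand, while remaining
   extendable; conversely, unused leaves can be released again.

   Deleting a maximal non-expanding set of ports gives an extendable start, into
   which the D branch vertices are placed. The subdivided edges are then embedded
   one at a time: grow a coloured path from one end and a single edge from the
   other, continue from both by (D-1)-ary trees of depth k = ceil(log_(D-1) s)
   whose levels carry the prescribed colours, join two leaves by s-joinedness,
   and release all tree vertices off the resulting path. *)

Set Implicit Arguments.
Unset Strict Implicit.
Unset Printing Implicit Defensive.

Lemma sum_card_fibres (I J : finType) (h : I -> J) (K : {set I}) (X : {set J}) :
  \sum_(x in X) #|[set y in K | h y == x]| = #|[set y in K | h y \in X]|.
Proof.
rewrite -sum1_card (partition_big h (mem X)) /=; last by move=> y; rewrite inE => /andP[].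
apply: eq_bigr => x xX; rewrite -sum1_card; apply: eq_bigl => y.
by rewrite !inE; case: eqP => [->|]; rewrite ?xX ?andbT ?andbF.
Qed.

(** * Neighbourhoods of port sets, tight sets and extendability *)

Section Extendability.
Variables (V P : finType) (E : P -> pred V) (s D : nat).
Hypothesis joined : forall (X : {set P}) (Y : {set V}),
  s <= #|X| -> s <= #|Y| -> exists x y, [/\ x \in X, y \in Y & E x y].

Definition nbh (X : {set P}) : {set V} :=
  [set y | [exists x in X, E x y]].

Lemma nbhP (X : {set P}) y :
  reflect (exists2 x, x \in X & E x y) (y \in nbh X).
Proof. by rewrite inE; apply: exists_inP. Qed.

Lemma nbhU (X Y : {set P}) : nbh (X :|: Y) = nbh X :|: nbh Y.
Proof.
apply/setP=> y; rewrite in_setU; apply/nbhP/orP.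
  by case=> x /setUP[xX|xY] Exy; [left|right]; apply/nbhP; exists x.
by case=> /nbhP[x xX Exy]; exists x => //; rewrite inE xX ?orbT.
Qed.

Lemma nbhS (X Y : {set P}) : X \subset Y -> nbh X \subset nbh Y.
Proof.
by move/subsetP=> XY; apply/subsetP=> y /nbhP[x xX Exy]; apply/nbhP; exists x; first exact: XY.
Qed.

Lemma card_nbh (X : {set P}) : s <= #|X| -> #|V| < #|nbh X| + s.
Proof.
move=> sX; rewrite -(cardsC (nbh X)) ltn_add2l ltnNge; apply/negP=> sY.
have [x [y [xX /setCP yX Exy]]] := joined sX sY.
by apply: yX; apply/nbhP; exists x.
Qed.

(* [P] is the set of ports and [f x] the number of further neighbours outside the
   used set [U] that the port [x] must still be able to acquire. *)
Definition extendable (U : {set V}) (f : P -> nat) : bool :=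
  [forall X : {set P}, (#|X| <= 2 * s) ==> (\sum_(x in X) f x <= #|nbh X :\: U|)].

Lemma extendableP U f :
  reflect (forall X : {set P}, #|X| <= 2 * s -> \sum_(x in X) f x <= #|nbh X :\: U|)
          (extendable U f).
Proof. by apply: (iffP forallP) => H X; apply/implyP; apply: H. Qed.

Lemma extendable_le U f g : (forall x, g x <= f x) -> extendable U f -> extendable U g.
Proof.
move=> gf /extendableP H; apply/extendableP=> X /H; apply: leq_trans.
exact: leq_sum.
Qed.

(** For an extendable pair the inequality is an equality, its converse being extendability
    itself. *)
Definition tight (U : {set V}) f (X : {set P}) : bool :=
  (#|X| <= 2 * s) && (#|nbh X :\: U| <= \sum_(x in X) f x).

(** At least [s] ports have more than [#|V| - s] neighbours, hence more than [2 * s * D] outside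
    [U], whereas [2 * s] ports never demand more than [2 * s * D]. *)
Lemma tight_card (U : {set V}) f X : (forall x, f x <= D) ->
  #|U| + s + 2 * s * D <= #|V| -> tight U f X -> #|X| < s.
Proof.
move=> fD room /andP[X2s tX]; rewrite ltnNge; apply/negP=> /card_nbh nX.
have : \sum_(x in X) f x <= #|X| * D.
  by rewrite -sum_nat_const; apply: leq_sum.
have : #|nbh X| <= #|nbh X :\: U| + #|U|.
  rewrite -(cardsID U (nbh X)) addnC leq_add2l.
  by apply: subset_leq_card; apply: subsetIr.
have : #|X| * D <= 2 * s * D by rewrite leq_mul2r X2s orbT.
lia.
Qed.

(** Neighbourhood size is submodular and total demand is modular, so extendability at [X :&: Y]
    forces tightness of the union. The bounds by [s] keep the union within [2 * s] ports. *)
Lemma tightU U f (X Y : {set P}) : extendable U f -> #|X| < s -> #|Y| < s ->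
  tight U f X -> tight U f Y -> tight U f (X :|: Y).
Proof.
move=> /extendableP ext Xs Ys /andP[_ tX] /andP[_ tY].
have cXY := cardsUI X Y; apply/andP; split; first lia.
have XI : #|X :&: Y| <= 2 * s by lia.
have := ext _ XI.
have -> : nbh (X :|: Y) :\: U = (nbh X :\: U) :|: (nbh Y :\: U) by rewrite nbhU setDUl.
have cN := cardsUI (nbh X :\: U) (nbh Y :\: U).
have : #|nbh (X :&: Y) :\: U| <= #|(nbh X :\: U) :&: (nbh Y :\: U)|.
  by apply: subset_leq_card; rewrite subsetI !setSD // nbhS // (subsetIl, subsetIr).
have : \sum_(x in X :|: Y) f x + \sum_(x in X :&: Y) f x = \sum_(x in X) f x + \sum_(x in Y) f x.
  rewrite (big_setID Y (A := X :|: Y)) /= (big_setID Y (A := X)) /=.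
  have -> : (X :|: Y) :&: Y = Y by rewrite setIC; apply/setIidPl/subsetUr.
  have -> : (X :|: Y) :\: Y = X :\: Y by rewrite setDUl setDv setU0.
  lia.
lia.
Qed.

(** Tight sets are merged one by one with [tightU]; [tight_card] supplies its size bounds. Through
    [A] a chosen port can be kept out of the union. *)
Lemma tight_cover (U : {set V}) f (A : {set P}) (zs : seq V) :
  (forall x, f x <= D) -> #|U| + s + 2 * s * D <= #|V| -> extendable U f ->
  (forall y, y \in zs -> exists X, [/\ tight U f X, X \subset A & y \in nbh X]) ->
  exists X, [/\ tight U f X, X \subset A & {subset zs <= nbh X}].
Proof.
move=> fD room ext; elim: zs => [|z zs IH] H.
  exists set0; split; rewrite ?sub0set //.
  rewrite /tight cards0 /= big_set0.
  by rewrite leqn0 cards_eq0 -subset0; apply/subsetP=> y /setDP[/nbhP[x]]; rewrite inE.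
have [|X [tX dX sX]] := IH; first by move=> y yz; apply: H; rewrite inE yz orbT.
have [|Y [tY dY zY]] := H z; first by rewrite inE eqxx.
exists (X :|: Y); split.
- by apply: tightU => //; apply: tight_card tX || apply: tight_card tY.
- by rewrite subUset dX.
- move=> y; rewrite inE nbhU in_setU => /predU1P[->|/sX ->] //.
  by rewrite zY orbT.
Qed.

(* If every candidate [y] failed, the tight sets responsible would have a tight
   union covering all neighbours of [x] outside [U], and adding [x] to it would
   violate extendability. *)
Lemma extendable_leaf (U : {set V}) f x : (forall x, f x <= D) ->
  #|U| + s + 2 * s * D <= #|V| -> extendable U f -> 0 < f x ->
  exists y, [/\ E x y, y \notin U &
    extendable (y |: U) (fun z => f z - (z == x))].
Proof.
move=> fD room ext fx0.
case: (pickP [pred y | [&& E x y, y \notin U &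
    extendable (y |: U) (fun z => f z - (z == x))]]) => [y /and3P[] *|none]; first by exists y.
have [|X [tX dX sX]] := @tight_cover U f (~: [set x]) (enum [set y | E x y & y \notin U]) fD room ext.
  move=> y; rewrite mem_enum inE => /andP[Exy yU].
  have := none y; rewrite /= Exy yU /= => /negbT /forallPn[X].
  rewrite negb_imply -ltnNge => /andP[X2s lt].
  move/extendableP/(_ X X2s): ext => eX.
  have eqN : nbh X :\: (y |: U) = (nbh X :\: U) :\ y by rewrite setUC setDDl.
  have cY := cardsD1 y (nbh X :\: U); rewrite -eqN in cY.
  (* If [x] were in [X], the demand would drop by at least one, which offsets the possible loss of
     [y]. *)
  have xX : x \notin X.
    apply/negP=> xX.
    have lt' : \sum_(z in X) (f z - (z == x)) < \sum_(z in X) f z.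
      rewrite (big_setD1 x xX) [X in _ < X](big_setD1 x xX) /= eqxx.
      by rewrite -addSn leq_add ?leq_sum //; lia.
    by move: (y \in _) cY => []; lia.
  have eqs : \sum_(z in X) (f z - (z == x)) = \sum_(z in X) f z.
    by apply: eq_bigr => z zX; case: eqP zX xX => [->->|]; rewrite ?subn0.
  rewrite eqs in lt.
  (* The demand of [X] is unchanged, so the violation can only come from losing [y]. *)
  have yN : y \in nbh X :\: U by move: (y \in _) cY => []; lia.
  exists X; split; last by case/setDP: yN.
    by rewrite /tight X2s; rewrite yN in cY; lia.
  by rewrite subsetC sub1set inE.
have xX : x \notin X by rewrite subsetC sub1set inE in dX.
have Xs := tight_card fD room tX.
case/andP: tX => _ tX.
have /extendableP/(_ (x |: X)) := ext.
rewrite cardsU1 xX big_setU1 //= nbhU.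
have -> : (nbh [set x] :|: nbh X) :\: U = nbh X :\: U.
  rewrite setDUl; apply/setUidPr/subsetP=> y /setDP[/nbhP[x' /set1P->] Exy yU].
  by rewrite inE yU sX // mem_enum inE Exy.
lia.
Qed.

(** If every candidate failed, a single tight set would be adjacent to all of [~: U]. Having fewer
    than [s] ports it demands at most [s * D], less than [#|~: U|]. *)
Lemma extendable_vertex (U : {set V}) f : (forall x, f x <= D) ->
  #|U| + s + 2 * s * D <= #|V| -> 0 < s -> extendable U f ->
  exists2 y, y \notin U & extendable (y |: U) f.
Proof.
move=> fD room s0 ext.
case: (pickP [pred y | (y \notin U) && extendable (y |: U) f]) => [y /andP[]|none]; first by exists y.
have [|X [tX _ sX]] := @tight_cover U f setT (enum (~: U)) fD room ext.
  move=> y; rewrite mem_enum inE => yU.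
  have := none y; rewrite /= yU /= => /negbT /forallPn[X].
  rewrite negb_imply -ltnNge => /andP[X2s lt].
  move/extendableP/(_ X X2s): ext => eX.
  have eqN : nbh X :\: (y |: U) = (nbh X :\: U) :\ y by rewrite setUC setDDl.
  have cY := cardsD1 y (nbh X :\: U); rewrite -eqN in cY.
  have yN : y \in nbh X :\: U by move: (y \in _) cY => []; lia.
  exists X; split; last by case/setDP: yN.
    by rewrite /tight X2s; rewrite yN in cY; lia.
  exact: subsetT.
have Xs := tight_card fD room tX.
case/andP: tX => _; rewrite leqNgt => /negP[].
have -> : nbh X :\: U = ~: U.
  apply/setP=> y; rewrite !inE; case: (boolP (y \in U)) => //= yU.
  by have := sX y; rewrite mem_enum !inE yU; apply.
have : \sum_(x in X) f x <= #|X| * D by rewrite -sum_nat_const; apply: leq_sum.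
have := cardsC U.
have : #|X| * D <= s * D by rewrite leq_mul2r (ltnW Xs) orbT.
lia.
Qed.

(** Each released vertex attached to a port of [X] is a new free neighbour of [X], which pays for
    the unit of demand returned to that port. *)
Lemma extendable_remove (U K : {set V}) f (pi : V -> P) :
  K \subset U -> (forall y, y \in K -> E (pi y) y) -> extendable U f ->
  extendable (U :\: K) (fun x => f x + #|[set y in K | pi y == x]|).
Proof.
move=> KU EK /extendableP ext; apply/extendableP=> X /ext leX.
rewrite big_split /= sum_card_fibres.
apply: (leq_trans (n := #|nbh X :\: U| + #|[set y in K | pi y \in X]|)); first by rewrite leq_add2r.
have dis : (nbh X :\: U) :&: [set y in K | pi y \in X] = set0.
  apply/setP=> y; rewrite !inE; apply/negP=> /andP[/andP[yU _] /andP[yK _]].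
  by rewrite (subsetP KU) in yU.
rewrite -cardsUI dis cards0 addn0.
apply/subset_leq_card/subsetP=> y /setUP[/setDP[yN yU]|].
  by rewrite !inE (negbTE yU) andbF /=; rewrite inE in yN.
rewrite inE => /andP[yK piX]; rewrite inE inE yK /=.
by apply/nbhP; exists (pi y) => //; apply: EK.
Qed.

(* [pi] records the port through which each vertex of the new level is attached,
   so that [extendable_remove] can later give back its demand. *)
Lemma extendable_level (U : {set V}) f (A : {set P}) w m (x0 : P) : (forall x, f x <= D) ->
  extendable U f -> (forall x, x \in A -> w <= f x) -> m <= w * #|A| ->
  #|U| + m + s + 2 * s * D <= #|V| ->
  exists (L : {set V}) (pi : V -> P),
    [/\ #|L| = m, (forall y, y \in L -> y \notin U),
       (forall y, y \in L -> pi y \in A /\ E (pi y) y) &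
       extendable (U :|: L) (fun x => f x - #|[set y in L | pi y == x]|)].
Proof.
move=> fD ext wf; elim: m => [|m IH] mA room.
  exists set0, (fun=> x0); split; rewrite ?cards0 ?setU0 //; try by move=> y; rewrite inE.
  by apply: extendable_le ext => x; apply: leq_subr.
have [||L [pi [cL LU piL extL]]] := IH; [lia|lia|].
(* Pigeonhole: if every port of [A] already had [w] children, [L] would have at least [w * #|A|]
   vertices. *)
have [x xA lt_x] : exists2 x, x \in A & #|[set y in L | pi y == x]| < w.
  apply/exists_inP; apply: contraT => /exists_inPn ge_w.
  suff : w * #|A| <= m by lia.
  rewrite mulnC -sum_nat_const -cL.
  apply: (leq_trans (n := #|[set y in L | pi y \in A]|)); last first.
    by apply/subset_leq_card/subsetP=> y; rewrite inE => /andP[].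
  by rewrite -sum_card_fibres; apply: leq_sum => x /ge_w; rewrite -leqNgt.
have cUL : #|U :|: L| <= #|U| + m by rewrite -cL leq_card_setU.
have [||||y [Exy yUL exty]] := @extendable_leaf (U :|: L) (fun x => f x - #|[set y in L | pi y == x]|) x.
- by move=> z; apply: leq_trans (leq_subr _ _) (fD z).
- by lia.
- by [].
- by rewrite subn_gt0; apply: leq_trans lt_x (wf x xA).
have [yU yL] : y \notin U /\ y \notin L by apply/norP; rewrite -in_setU.
exists (y |: L), (fun z => if z == y then x else pi z); split.
- by rewrite cardsU1 yL cL.
- by move=> z /setU1P[->|/LU].
- by move=> z /setU1P[->|zL]; rewrite ?eqxx //; case: eqP zL yL => [->->|_ /piL].
rewrite setUCA; apply: extendable_le exty => z; rewrite -subnDA leq_sub2l //.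
set K := [set y0 in L | pi y0 == z].
have -> : #|K| + (z == x) = #|if z == x then y |: K else K|.
  by case: ifP => _; rewrite ?addn0 // cardsU1 inE (negbTE yL) addnC.
apply/subset_leq_card/subsetP=> y'; case: ifP => [/eqP zx|_] /=; rewrite !inE.
  by case: (eqVneq y' y) => [->|_]; rewrite ?zx ?eqxx.

by case: (eqVneq y' y) => [->|_] /=; rewrite ?(negbTE yL).
Qed.

Lemma extendable_start (src : P -> V) : 3 * s * D + 6 * s <= #|V| ->
  exists (U : {set V}) (f : P -> nat), [/\ #|U| <= D.+1 * s, extendable U f, forall x, f x <= D &
    forall x, src x \notin U -> f x = D].
Proof.
move=> room.
(* The sources of the ports in [B] are blocked as well, since those ports get
   demand 0; this costs one extra vertex per port. *)
pose R (B : {set P}) := nbh B :|: [set src x | x in B].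
pose Q (B : {set P}) := (#|B| <= 2 * s) && (#|R B| <= D.+1 * #|B|).
have [|B /maxsetP[/andP[B2s PB] maxB] _] := @maxset_exists _ Q set0.
  rewrite /Q cards0 /= muln0 leqn0 cards_eq0 /R imset0 setU0 -subset0.
  by apply/subsetP=> y /nbhP[x]; rewrite inE.
have small C : Q C -> #|C| < s.
  move=> /andP[C2s PC]; rewrite ltnNge; apply/negP=> /card_nbh.
  have : #|nbh C| <= #|R C| by apply: subset_leq_card; apply: subsetUl.
  have : D.+1 * #|C| <= D.+1 * (2 * s) by rewrite leq_mul2l C2s orbT.
  nia.
have Bs : #|B| < s by apply: small; rewrite /Q B2s.
exists (R B), (fun x => if x \in B then 0 else D); split.
- by apply: leq_trans PB _; rewrite leq_mul2l ltnW ?orbT.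
- apply/extendableP=> X X2s; rewrite leqNgt; apply/negP=> lt.
  have sumf : \sum_(x in X) (if x \in B then 0 else D) = #|X :\: B| * D.
    rewrite (big_setID B) /= big1 ?add0n; last by move=> x /setIP[_ ->].
    rewrite -sum_nat_const; apply: eq_bigr => x /setDP[_ xB].
    by rewrite (negbTE xB).
  have YX : #|X :\: B| <= #|X| by apply/subset_leq_card/subsetDl.
  have NYX : #|nbh (X :\: B) :\: R B| <= #|nbh X :\: R B|.
    by apply/subset_leq_card/setSD/nbhS/subsetDl.
  rewrite {}sumf in lt; set Y := X :\: B in YX NYX lt.
  have cR : #|nbh Y| <= #|nbh Y :\: R B| + #|R B|.
    rewrite -(cardsID (R B) (nbh Y)) addnC leq_add2l.
    by apply: subset_leq_card; apply: subsetIr.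
  have BD : D.+1 * #|B| <= D.+1 * s by rewrite leq_mul2l ltnW ?orbT.
  have YD : #|Y| * D <= 2 * s * D by rewrite leq_mul2r; apply/orP; right; lia.
  (* A large [Y] has too many neighbours to violate the demand. A small one can be added to [B], so
     it is empty by maximality and demands nothing. *)
  have [/card_nbh|Ys] := leqP s #|Y|; first by nia.
  have cBY : #|B :|: Y| = #|B| + #|Y|.
    have dBY : B :&: Y = set0 by rewrite setIDA setIC -setIDA setDv setI0.
    by have := cardsUI B Y; rewrite dBY cards0; lia.
  have PBY : Q (B :|: Y).
    rewrite /Q cBY; apply/andP; split; first lia.
    have sub : R (B :|: Y) \subset R B :|: (nbh Y :\: R B) :|: [set src x | x in Y].
      rewrite /R nbhU imsetU; apply/subsetP=> y.
      by rewrite !in_setU in_setD !in_setU; do 4 case: (y \in _).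
    have := subset_leq_card sub.
    have := leq_card_setU (R B :|: (nbh Y :\: R B)) [set src x | x in Y].
    have := leq_card_setU (R B) (nbh Y :\: R B).
    have imY : #|[set src x | x in Y]| <= #|Y| by apply: leq_imset_card.
    by move=> [? _] [? _]; lia.
  have := maxB _ PBY (subsetUl _ _) => BYB; rewrite BYB in cBY.
  have Y0 : #|Y| = 0 by lia.
  by rewrite Y0 mul0n in lt.
- by move=> x; case: ifP.
- move=> x xR; case: ifP => // xB.
  by case/negP: xR; rewrite inE; apply/orP; right; apply/imsetP; exists x.
Qed.
End Extendability.

(** * Linking two vertex sets by a path with prescribed colours *)

Section Linking.
Variables (V : finType) (t : nat) (G : 'I_t -> rel V) (s D q : nat).
Hypotheses (joined : s_joined G s) (Gsym : forall i, symmetric (G i)).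
Hypotheses (s_gt0 : 0 < s) (qD : q <= D).

Definition port_adj (x : V * 'I_t) : pred V := G x.2 x.1.

Lemma port_joined (X : {set V * 'I_t}) (Y : {set V}) :
  s <= #|X| -> s <= #|Y| -> exists x y, [/\ x \in X, y \in Y & port_adj x y].
Proof. by move=> sX sY; have [v [i [y H]]] := joined sX sY; exists (v, i), y. Qed.

Fixpoint walk (v : V) (p : seq V) (cs : seq 'I_t) : bool :=
  match p, cs with
  | y :: p', c :: cs' => G c v y && walk y p' cs'
  | [::], [::] => true
  | _, _ => false
  end.

(* Levels of sizes [ms] can be grown on [n] vertices, each having at most [w]
   children in the first new level and [q] children in later ones, and the last
   level has at least [s] vertices. *)
Fixpoint level_sizes (w n : nat) (ms : seq nat) : bool :=
  if ms is m :: ms' then (m <= w * n) && level_sizes q m ms' else s <= n.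

(* No demand is kept at the inner vertices [p1 ++ p2] of the path, and at its two
   ends the demand is lowered in every colour, which is wasteful but harmless. *)
Definition linked (U : {set V}) f (A B : {set V}) cs1 cs2 c : Prop :=
  exists a b p1 p2,
    [/\ [/\ a \in A, b \in B & uniq (p1 ++ p2)],
        [/\ walk a p1 cs1, walk b p2 cs2 & G c (last a p1) (last b p2)],
        (forall y, y \in p1 ++ p2 -> y \notin U) &
        extendable port_adj s (U :|: [set:: p1 ++ p2])
          (fun x => if x.1 \in p1 ++ p2 then 0 else f x - (x.1 == a) - (x.1 == b))].

(** The state and the end sets are quantified here so that an induction on the colours can replace
    [A] by the next grown level. *)
Definition linkable cs1 ms1 cs2 ms2 c : Prop :=
  forall (U : {set V}) f (A B : {set V}) w1 w2,
    extendable port_adj s U f -> (forall x, f x <= D) ->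
    (forall x, x.1 \notin U -> f x = D) ->
    A \subset U -> B \subset U -> [disjoint A & B] ->
    (forall x, x.1 \in A -> w1 <= f x) -> (forall x, x.1 \in B -> w2 <= f x) ->
    level_sizes w1 #|A| ms1 -> level_sizes w2 #|B| ms2 ->
    #|U| + sumn ms1 + sumn ms2 + s + 2 * s * D <= #|V| ->
    linked U f A B cs1 cs2 c.

Lemma linkable_nil c : linkable [::] [::] [::] [::] c.
Proof.
move=> U f A B w1 w2 ext fD fU AU BU dAB fA fB /= sA sB room.
have sX : s <= #|[set (a, c) | a in A]| by rewrite card_imset // => a a' [].
have [_ [b [/imsetP[a aA ->] bB Gab]]] := port_joined sX sB.
exists a, b, [::], [::]; split=> //=.
have -> : [set:: Nil V] = set0 by apply/setP=> y; rewrite !inE.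
by rewrite setU0; apply: extendable_le ext => x; rewrite -subnDA leq_subr.
Qed.

Lemma linkable_sym cs1 ms1 cs2 ms2 c :
  linkable cs1 ms1 cs2 ms2 c -> linkable cs2 ms2 cs1 ms1 c.
Proof.
move=> H U f A B w1 w2 ext fD fU AU BU dAB fA fB sA sB room.
have [||b [a [p1 [p2 [[bB aA up] [wb wa Gba] pU ext']]]]] := H U f B A w2 w1 ext fD fU BU AU _ fB fA sB sA.
- by rewrite disjoint_sym.
- by apply: leq_trans room; lia.
have eqp : p2 ++ p1 =i p1 ++ p2 by move=> y; rewrite !mem_cat orbC.
exists a, b, p2, p1; split.
- by split=> //; rewrite uniq_catC.
- by split=> //; rewrite Gsym.
- by move=> y; rewrite eqp; apply: pU.
have -> : [set:: p2 ++ p1] = [set:: p1 ++ p2] by apply/setP=> y; rewrite !inE eqp.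
by apply: extendable_le ext' => x; rewrite eqp; case: ifP => // _; rewrite subnAC.
Qed.

(** Grow a level [L] from [A] in colour [c1], link [L] to [B], then release all of [L] except the
    vertex [a'] where the link starts. *)
Lemma linkable_cons c1 m cs1 ms1 cs2 ms2 c :
  linkable cs1 ms1 cs2 ms2 c -> linkable (c1 :: cs1) (m :: ms1) cs2 ms2 c.
Proof.
move=> H U f A B w1 w2 ext fD fU AU BU dAB fA fB /= /andP[mA sA] sB room.
have cA : #|[set (a, c1) | a in A]| = #|A| by rewrite card_imset // => a a' [].
have V0 : 0 < #|V| by apply: leq_trans room; lia.
have /card_gt0P[v _] := V0.
have [|||L [pi [cL LU piL extL]]] := @extendable_level _ _ port_adj s D port_joined U f
  [set (a, c1) | a in A] w1 m (v, c1) fD ext.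
- by move=> _ /imsetP[a aA ->]; apply: fA.
- by rewrite cA.
- by apply: leq_trans room; lia.
set g := (fun x => _) in extL.
have fg x : x.1 \notin A -> g x = f x.
  move=> xA; rewrite /g; set K := [set _ | _ & _].
  have -> : K = set0; last by rewrite cards0 subn0.
  apply/setP=> y; rewrite !inE; apply/negP=> /andP[/piL[/imsetP[a aA ->] _] /eqP ax].
  by rewrite -ax aA in xA.
have cUL : #|U :|: L| <= #|U| + m by rewrite -cL leq_card_setU.
have LB : [disjoint L & B].
  rewrite -setI_eq0 -subset0; apply/subsetP=> y /setIP[/LU yU /(subsetP BU)].
  by rewrite (negbTE yU).
have LA y : y \in L -> y \notin A by move/LU; apply: contra => /(subsetP AU).
have [||||||||||a' [b [p1 [p2 [[aL bB up] [wa wb Gab] pU ext']]]]] := H (U :|: L) g L B q w2 extL.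
- by move=> x; apply: leq_trans (leq_subr _ _) (fD x).
- by move=> x; rewrite in_setU negb_or => /andP[xU xL]; rewrite fg ?fU //; apply: contra xU => /(subsetP AU).
- exact: subsetUr.
- exact: subset_trans BU (subsetUl _ _).
- exact: LB.
(* Fresh vertices still have full demand [D], which allows [q] children each. *)
- by move=> x xL; rewrite fg ?LA // fU ?LU.
- move=> x xB; rewrite fg ?fB //; apply/negP=> xA.
  by have := disjointFr dAB xA; rewrite xB.
- by rewrite cL.
- exact: sB.
- by apply: leq_trans room; lia.
have [/imsetP[a aA eqpi] Ga] := piL _ aL.
have a'p : a' \notin p1 ++ p2.
  by apply/negP=> /pU; rewrite in_setU aL orbT.
exists a, b, (a' :: p1), p2; split.
- by rewrite /= a'p.
- by rewrite /= wa andbT; rewrite eqpi in Ga.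
- move=> y; rewrite /= inE => /predU1P[->|/pU]; first exact: LU.
  by rewrite in_setU negb_or => /andP[].
have := @extendable_remove _ _ port_adj s (U :|: L :|: [set:: p1 ++ p2]) (L :\ a') _ pi _ _ ext'.
have -> : (U :|: L :|: [set:: p1 ++ p2]) :\: (L :\ a') = U :|: [set:: (a' :: p1) ++ p2].
  apply/setP=> y; rewrite !inE /=.
  case: (eqVneq y a') => [->|_] /=; first by rewrite aL orbT.
  case: (boolP (y \in L)) => /= yL; last by rewrite orbF.
  have := pU y; rewrite in_setU yL orbT (negbTE (LU _ yL)) /=.
  by case: (y \in p1 ++ p2) => // /(_ isT).
move=> R; have {}R := R _ _; apply: extendable_le (R _ _).
- move=> x /=; rewrite inE; case: (eqVneq x.1 a') => //= xa'.
  case: ifP => // xp.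
  have : #|[set y in L | pi y == x]| = (pi a' == x) + #|[set y in L :\ a' | pi y == x]|.
    rewrite (cardsD1 a') inE aL /=; congr (_ + _).
    by apply: eq_card => y; rewrite !inE andbA.
  (* After the release the only child still charged to a port is [a'], and its port lies at [a]. *)
  have : (pi a' == x) <= (x.1 == a).
    by rewrite eqpi; case: eqP => // <-; rewrite eqxx.
  rewrite /g => le_pi ->; move: (f x) #|_| le_pi => fx N; clear.
  move: (nat_of_bool (pi a' == x)) (nat_of_bool (x.1 == a)) (nat_of_bool (x.1 == b)) => i j k; lia.
- by apply/subsetP=> y /setD1P[_ yL]; rewrite !in_setU yL orbT.
- by move=> y /setD1P[_ /piL[]].
Qed.

Lemma linkable_seq cs1 ms1 cs2 ms2 c : size cs1 = size ms1 -> size cs2 = size ms2 ->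
  linkable cs1 ms1 cs2 ms2 c.
Proof.
elim: cs1 ms1 => [|c1 cs1 IH] [|m1 ms1] //=; last by move=> [e1] e2; apply/linkable_cons/IH.
move=> _; elim: cs2 ms2 => [|c2 cs2 IH2] [|m2 ms2] //= => [_|[e2]]; first exact: linkable_nil.
by apply/linkable_sym/linkable_cons/linkable_sym/IH2.
Qed.
End Linking.

(** * Level sizes of the branching trees *)

Section TreeSizes.
Variables (s q : nat).
Hypotheses (s_gt0 : 0 < s) (q_gt1 : 1 < q).

(* The fewest vertices from which [q]-fold branching reaches [s] leaves in
   [k.-1, ..., 0] further levels. *)
Fixpoint tree_sizes k :=
  if k is k'.+1 then (s.-1 %/ q ^ k').+1 :: tree_sizes k' else [::].

Lemma size_tree_sizes k : size (tree_sizes k) = k.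
Proof. by elim: k => //= k ->. Qed.

Lemma level_sizes_tree k n : s.-1 %/ q ^ k < n -> level_sizes s q q n (tree_sizes k).
Proof.
elim: k n => [|k IH] n /=; first by rewrite divn1; lia.
move=> lt; rewrite IH // andbT mulnC -ltn_divLR ?(ltnW q_gt1) //.
by rewrite -divnMA -expnSr.
Qed.

(** The single-vertex levels form a bare path; its last vertex alone suffices to start the tree
    because [s <= q ^ k]. *)
Lemma level_sizes_path k w n : s <= q ^ k -> 0 < w * n ->
  forall j, level_sizes s q w n (nseq j.+1 1 ++ tree_sizes k).
Proof.
move=> sk wn j; elim: j w n wn => [|j IH] w n wn /=; rewrite wn /=.
  by apply: level_sizes_tree; rewrite divn_small //; lia.
by apply: IH; lia.
Qed.

(** Geometric sum: the extra term on the left makes the induction close, since the quotient at least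
    halves with each level. *)
Lemma sumn_tree_sizes k : sumn (tree_sizes k) + 2 * (s.-1 %/ q ^ k) <= k + 2 * s.-1.
Proof.
elim: k => [|k IH] /=; first by rewrite divn1.
have : (s.-1 %/ q ^ k.+1) * 2 <= s.-1 %/ q ^ k.
  rewrite expnSr divnMA; apply: leq_trans (leq_divM _ q).
  by rewrite leq_mul2l q_gt1 orbT.
lia.
Qed.
End TreeSizes.

(** The ends are only known to have positive demand, so each side starts with a single edge before
    branching. The two trees cost at most [4 * s] beyond the path lengths, and [linkable] asks for
    [s] more. *)
Lemma linked_path (V : finType) t (G : 'I_t -> rel V) s D q (U : {set V}) f x y cs1 cs2 c :
  s_joined G s -> (forall i, symmetric (G i)) -> 0 < s -> 1 < q <= D ->
  extendable (port_adj G) s U f -> (forall z, f z <= D) ->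
  (forall z, z.1 \notin U -> f z = D) ->
  x \in U -> y \in U -> x != y -> (forall i, 0 < f (x, i)) -> (forall i, 0 < f (y, i)) ->
  up_log q s < size cs1 -> size cs2 = (up_log q s).+1 ->
  #|U| + size cs1 + size cs2 + 5 * s + 2 * s * D <= #|V| ->
  linked G s U f [set x] [set y] cs1 cs2 c.
Proof.
move=> joined Gsym s0 /andP[q1 qD] ext fD fU xU yU xy fx fy lt1 e2 room.
set k := up_log q s in lt1 e2.
have sk : s <= q ^ k by apply: up_logP.
pose ms j := nseq j.+1 1 ++ tree_sizes s q k.
have sz j : size (ms j) = (j + k).+1 by rewrite size_cat size_nseq size_tree_sizes.
have sm j : sumn (ms j) <= j.+1 + k + 2 * s.-1.
  rewrite sumn_cat sumn_nseq mul1n -addnA leq_add2l.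
  exact: leq_trans (leq_addr _ _) (sumn_tree_sizes s0 q1 k).
have ez : size cs1 = size (ms (size cs1 - k.+1)) by rewrite sz; lia.
have ez2 : size cs2 = size (ms 0) by rewrite sz e2.
apply: (linkable_seq joined Gsym s0 qD c ez ez2) ext fD fU _ _ _ _ _ _ _ _.
- by rewrite sub1set.
- by rewrite sub1set.
- by rewrite disjoints1 inE.
- by move=> [z i] /set1P /= ->; exact: (fx i).
- by move=> [z i] /set1P /= ->; exact: (fy i).
- by apply: level_sizes_path => //; rewrite cards1.
- by apply: level_sizes_path => //; rewrite cards1.
- have := sm 0; have := sm (size cs1 - k.+1) => *.
  apply: leq_trans room; lia.
Qed.

(** * Auxiliary facts on paths, lists and placing several vertices *)

Lemma path_rev_sym (T : Type) (R : rel T) x y p : symmetric R ->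
  path R x (rcons (rev p) y) = path R y (rcons p x).
Proof.
move=> Rsym; have := rev_path R y (rcons p x).
rewrite last_rcons belast_rcons rev_cons => ->.
by apply: eq_path => u v; rewrite Rsym.
Qed.

Lemma path_zip (T : eqType) (R : rel T) x p u v :
  path R x p -> (u, v) \in zip (x :: p) p -> R u v.
Proof.
elim: p x => //= y p IH x /andP[Rxy yp]; rewrite inE => /predU1P[[-> ->] //|].
exact: IH.
Qed.

Lemma map_nth_index (T1 T2 : eqType) (x0 : T2) (p : seq T1) (q : seq T2) :
  uniq p -> size p = size q -> [seq nth x0 q (index x p) | x <- p] = q.
Proof.
move=> up eqs; apply: (@eq_from_nth _ x0); first by rewrite size_map.
rewrite size_map => i ip; case: p up eqs ip => // z p up eqs ip.
by rewrite (nth_map z) // index_uniq.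
Qed.

Lemma extendable_vertices (V P : finType) (E : P -> pred V) s D (U : {set V}) f m :
  (forall (X : {set P}) (Y : {set V}),
    s <= #|X| -> s <= #|Y| -> exists x y, [/\ x \in X, y \in Y & E x y]) ->
  0 < s -> (forall x, f x <= D) -> extendable E s U f ->
  #|U| + m + s + 2 * s * D <= #|V| ->
  exists vs : seq V, [/\ size vs = m, uniq vs, (forall y, y \in vs -> y \notin U) &
    extendable E s (U :|: [set:: vs]) f].
Proof.
move=> joined s0 fD ext; elim: m => [|m IH] room.
  have set_nil : [set:: [::]] = set0 :> {set V} by apply/setP=> y; rewrite !inE.
  by exists [::]; split; rewrite ?set_nil ?setU0.
have [|vs [svs uvs vsU extvs]] := IH; first by apply: leq_trans room; lia.
have cvs : #|U :|: [set:: vs]| <= #|U| + m.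
  have <- : #|[set:: vs]| = m by rewrite cardsE (card_uniqP uvs).
  exact: leq_card_setU.
have [|y yU exty] := extendable_vertex joined fD _ s0 extvs.
  by apply: leq_trans room; lia.
rewrite in_setU inE negb_or in yU; case/andP: yU => yU yvs.
exists (y :: vs); split=> /=.
- by rewrite svs.
- by rewrite yvs.
- by move=> z; rewrite inE => /predU1P[->|/vsU].
suff -> : U :|: [set:: y :: vs] = y |: (U :|: [set:: vs]) by [].
by apply/setP=> z; rewrite !inE orbCA.
Qed.

Lemma walk_size (V : finType) t (G : 'I_t -> rel V) v p cs : walk G v p cs -> size p = size cs.
Proof. by elim: p v cs => [|y p IH] v [|c cs] //= /andP[_ /IH ->]. Qed.

(** * Embedding the branch vertices and then the subdivided edges *)

Section Embedding.
Variables (V W : finType) (t : nat) (G : 'I_t -> rel V) (s D : nat).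
Variables (e : rel W) (c : W -> W -> 'I_t).
Variables (b : 'I_D -> W) (p : 'I_D -> 'I_D -> seq W).
Hypotheses (s_gt0 : 0 < s) (D_gt2 : 2 < D).
Hypotheses (joined : s_joined G s) (Gsym : forall i, symmetric (G i)).
Hypotheses (esym : symmetric e) (csym : forall u v, e u v -> c u v = c v u).
Hypothesis b_inj : injective b.
Hypothesis p_path : forall i j : 'I_D, i < j ->
  [/\ path e (b i) (rcons (p i j) (b j)),
      uniq (branch_path (b i) (b j) (p i j)),
      2 * up_log D.-1 s + 3 <= (size (p i j)).+1 &
      forall x, x \in p i j -> forall k, x != b k].
Hypothesis p_disj : forall i j i' j' : 'I_D, i < j -> i' < j' -> (i, j) != (i', j') ->
  forall x, x \in p i j -> x \notin p i' j'.
Hypothesis room : #|W| + 6 * s * D <= #|V|.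

(** Including [e u v] makes the relation symmetric, as [c] is known to be symmetric on edges
    only. *)
Definition preserved (phi : W -> V) (u v : W) : bool :=
  e u v && G (c u v) (phi u) (phi v).

Lemma preserved_sym phi : symmetric (preserved phi).
Proof.
move=> u v; rewrite /preserved [e v u]esym; case: (boolP (e u v)) => //= uv.
by rewrite csym // Gsym.
Qed.

Lemma walk_preserved phi x r : path e x r ->
  walk G (phi x) (map phi r) (pairmap c x r) -> path (preserved phi) x r.
Proof.
elim: r x => //= y r IH x /andP[xy yr] /andP[Gxy wr].
by rewrite /preserved xy Gxy; apply: IH.
Qed.

Definition dom (ps : seq ('I_D * 'I_D)) : {set W} :=
  [set x | (x \in codom b) || has (fun ij => x \in p ij.1 ij.2) ps].

Definition incident (k : 'I_D) (ij : 'I_D * 'I_D) : bool := (ij.1 == k) || (ij.2 == k).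

(** Sending each pair at [k] to its other entry is injective and misses [k]. *)
Lemma incident_count k (ps : seq ('I_D * 'I_D)) :
  uniq ps -> (forall ij, ij \in ps -> ij.1 < ij.2) -> count (incident k) ps < D.
Proof.
move=> ups lt; pose h (ij : 'I_D * 'I_D) := if ij.1 == k then ij.2 else ij.1.
have uh : uniq (k :: map h (filter (incident k) ps)).
  rewrite /= map_inj_in_uniq ?filter_uniq // ?andbT.
    apply/mapP=> -[ij]; rewrite mem_filter => /andP[_ /lt ltij]; rewrite /h.
    by case: (eqVneq ij.1 k) => [<- e12|ne e1]; [rewrite -e12 ltnn in ltij|rewrite -e1 eqxx in ne].
  move=> [i1 j1] [i2 j2]; rewrite !mem_filter /h /incident /=.
  move=> /andP[in1 /lt /= lt1] /andP[in2 /lt /= lt2].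
  case: eqP in1 lt1 => [-> _ lt1|_ /eqP -> lt1];
    case: eqP in2 lt2 => [-> _ lt2|_ /eqP -> lt2] //=.
  - by move=> ->.
  - by move=> e1; rewrite e1 ltnNge (ltnW lt2) in lt1.
  - by move=> e1; rewrite e1 ltnNge (ltnW lt2) in lt1.
  - by move=> ->.
have := uniq_leq_size uh (s2 := enum 'I_D).
rewrite /= size_map size_filter size_enum_ord; apply.
by move=> x _; rewrite mem_enum.
Qed.

(* A branch vertex loses at most one unit of demand for each embedded path ending
   in it. [D.+1 * s] bounds the vertices blocked in [extendable_start]. *)
Definition embeddable (ps : seq ('I_D * 'I_D)) : Prop :=
  exists (phi : W -> V) (U : {set V}) (f : V * 'I_t -> nat),
    [/\ {in dom ps &, injective phi},
        {in ps, forall ij, path (preserved phi) (b ij.1) (rcons (p ij.1 ij.2) (b ij.2))},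
        [/\ extendable (port_adj G) s U f, (forall x, f x <= D),
            (forall x, x.1 \notin U -> f x = D) &
            (forall k i, D <= f (phi (b k), i) + count (incident k) ps)],
        {in dom ps, forall x, phi x \in U} &
        #|U| <= D.+1 * s + #|dom ps|].

Lemma embeddable_nil : embeddable [::].
Proof.
have D2 : 2 * s <= s * D by rewrite mulnC leq_mul2l ltnW ?orbT.
have D3 : 3 * s <= s * D by rewrite mulnC leq_mul2l D_gt2 orbT.
have DW : D <= #|W| by rewrite -[D]card_ord; apply: leq_card b_inj.
have V0 : 0 < #|V| by apply: leq_trans room; lia.
have /card_gt0P[v0 _] := V0.
have [|U [f [cU ext fD fU]]] := extendable_start (port_joined joined) (D := D) (fun x => x.1).
  by apply: leq_trans room; lia.
have [|vs [svs uvs vsU extvs]] := @extendable_vertices _ _ _ _ D U f D (port_joined joined) s_gt0 fD ext.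
  by apply: leq_trans room; lia.
have cb : size (codom b) = D by rewrite size_codom card_ord.
have ub : uniq (codom b) by rewrite codomE map_inj_uniq ?enum_uniq.
pose phi x := nth v0 vs (index x (codom b)).
have idx x : x \in codom b -> index x (codom b) < size vs.
  by rewrite -index_mem cb svs.
have phi_vs x : x \in codom b -> phi x \in vs by move=> /idx; apply: mem_nth.
have domE : dom [::] =i codom b by move=> x; rewrite inE orbF.
exists phi, (U :|: [set:: vs]), f; split=> //.
- move=> x y; rewrite !domE => xb yb /eqP.
  by rewrite /phi nth_uniq ?idx // => /eqP; apply: index_inj.
- split=> //; first by move=> x; rewrite in_setU negb_or => /andP[xU _]; apply: fU.
  by move=> k i; rewrite addn0 fU //=; apply/vsU/phi_vs/codom_f.
- by move=> x; rewrite domE => xb; rewrite in_setU inE phi_vs ?orbT.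
have -> : #|dom [::]| = D by rewrite (eq_card domE) (card_uniqP ub).
apply: leq_trans (leq_card_setU _ _) _; rewrite leq_add //.
by rewrite cardsE (card_uniqP uvs) svs.
Qed.

Lemma embeddable_cons (i j : 'I_D) (ps : seq ('I_D * 'I_D)) : i < j -> (i, j) \notin ps -> uniq ps ->
  (forall ij, ij \in ps -> ij.1 < ij.2) -> embeddable ps -> embeddable ((i, j) :: ps).
Proof.
move=> ij ijps ups lt [phi [U [f [phi_inj phi_path [ext fD fU fb] phiU cU]]]].
have [pe up lp pb] := p_path ij.
(* The pair [(i, j)] is itself one of at most [D - 1] pairs at [k], so both ends retain positive
   demand. *)
have count_lt k : incident k (i, j) -> count (incident k) ps < D.-1.
  move=> kij; have := @incident_count k ((i, j) :: ps); rewrite /= kij ijps ups.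
  move=> /(_ isT) H; have : 1 + count (incident k) ps < D; last by lia.
  by apply: H => z; rewrite inE => /predU1P[->|/lt].
have fb_gt0 k l : incident k (i, j) -> 0 < f (phi (b k), l).
  by move=> /count_lt; have := fb k l; clear; lia.
have [bip bij bjp uij] : [/\ b i \notin p i j, b i != b j, b j \notin p i j & uniq (p i j)].
  move: up; rewrite /branch_path /= mem_rcons inE negb_or rcons_uniq.
  by move=> /andP[/andP[-> ->] /andP[-> ->]].
have dom_cons : dom ((i, j) :: ps) = dom ps :|: [set:: p i j].
  by apply/setP=> x; rewrite !inE /= orbCA orbC.
have dom_new x : x \in p i j -> x \notin dom ps.
  move=> xp; rewrite inE negb_or; apply/andP; split.
    by apply/negP=> /codomP[k xk]; have := pb x xp k; rewrite xk eqxx.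
  apply/hasPn=> -[i' j'] ijps' /=; apply: (p_disj ij (lt _ ijps')) => //.
  by apply: contraNneq ijps => ->.
have b_dom k : b k \in dom ps by rewrite inE codom_f.
have cdom : #|dom ((i, j) :: ps)| = #|dom ps| + size (p i j).
  rewrite dom_cons -(card_uniqP uij) -(cardsE (mem (p i j))) -cardsUI.
  suff -> : dom ps :&: [set:: p i j] = set0 by rewrite cards0 addn0.
  by apply/setP=> x; rewrite in_setI in_set0 inE; apply/negP=> /andP[xd /dom_new]; rewrite xd.
have cdomW : #|dom ((i, j) :: ps)| <= #|W| by apply: max_card.
set k := up_log D.-1 s in lp.
(* The last [k.+1] inner vertices, read backwards from [b j], provide one edge and [k] tree levels.
   The length hypothesis leaves at least [k.+1] for the side of [b i]. *)
pose p1 := take (size (p i j) - k.+1) (p i j).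
pose p2 := rev (drop (size (p i j) - k.+1) (p i j)).
have ep : p i j = p1 ++ rev p2 by rewrite revK cat_take_drop.
have sp2 : size p2 = k.+1 by rewrite size_rev size_drop; clear -lp; lia.
have sp1 : size p1 = size (p i j) - k.+1 by rewrite size_takel // leq_subr.
clearbody p1 p2.
have phi_ij : phi (b i) != phi (b j).
  by apply: contra bij => /eqP /phi_inj -> //.
(* Used vertices and the new path number at most [D.+1 * s + #|W|], so the total is
   [#|W| + 3 * s * D + 6 * s], which fits because [D] is at least 3. *)
have room_ij : #|U| + size (p i j) + 5 * s + 2 * s * D <= #|V|.
  apply: leq_trans room; have : 3 * s <= s * D by rewrite mulnC leq_mul2l D_gt2 orbT.
  clear -cU cdom cdomW; lia.
have [||||||||a [a' [q1 [q2 [[/set1P-> /set1P-> uq] [w1 w2 Gc] qU extq]]]]] :=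
  @linked_path V t G s D D.-1 U f (phi (b i)) (phi (b j)) (pairmap c (b i) p1)
   (pairmap c (b j) p2) (c (last (b i) p1) (last (b j) p2)) joined Gsym s_gt0 _ ext fD fU _ _ phi_ij.
- by clear -D_gt2; lia.
- exact: phiU.
- exact: phiU.
- by move=> l; apply: fb_gt0; rewrite /incident /= eqxx.
- by move=> l; apply: fb_gt0; rewrite /incident /= eqxx orbT.
- by rewrite size_pairmap sp1 -/k; clear -lp; lia.
- by rewrite size_pairmap sp2.
- by apply: leq_trans room_ij; rewrite !size_pairmap sp1 sp2; clear -lp; lia.
pose q := q1 ++ rev q2; pose v0 := phi (b i).
have eq_q : q =i q1 ++ q2 by move=> x; rewrite !mem_cat mem_rev.
have [sq1 sq2] : size q1 = size p1 /\ size q2 = size p2.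
  by split; rewrite ?(walk_size w1) ?(walk_size w2) size_pairmap.
have sq : size q = size (p i j) by rewrite ep /q !size_cat !size_rev sq1 sq2.
have uqq : uniq q.
  by rewrite (@perm_uniq _ q (q1 ++ q2)) // /q perm_cat2l perm_rev.
(* The default [v0] is never returned, since [q] and [p i j] have equal length. *)
pose phi' x := if x \in p i j then nth v0 q (index x (p i j)) else phi x.
have phi'_old x : x \in dom ps -> phi' x = phi x.
  by rewrite /phi'; case: ifP => // /dom_new /negP.
have phi'_new x : x \in p i j -> phi' x \in q.
  by move=> xp; rewrite /phi' xp mem_nth // sq index_mem.
have map_phi' : map phi' (p i j) = q.
  rewrite -[RHS](map_nth_index v0 uij) //.
  by apply/eq_in_map => x xp; rewrite /phi' xp.
have [m1 m2] : map phi' p1 = q1 /\ map phi' p2 = q2.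
  move/eqP: map_phi'; rewrite ep /q map_cat eqseq_cat ?size_map // map_rev.
  by move=> /andP[/eqP -> /eqP/(can_inj revK) ->].
have qU' x : x \in q -> x \notin U by rewrite eq_q; apply: qU.
exists phi', (U :|: [set:: q1 ++ q2]), (fun x => if x.1 \in q1 ++ q2 then 0
  else f x - (x.1 == phi (b i)) - (x.1 == phi (b j))); split.
- move=> x y; rewrite dom_cons !in_setU ![_ \in [set:: _]]inE.
  case: (boolP (x \in p i j)) => [xp _|xp xd]; case: (boolP (y \in p i j)) => [yp _|yp].
  + rewrite /phi' xp yp => /eqP; rewrite nth_uniq ?sq ?index_mem // => /eqP.
    exact: index_inj.
  + rewrite orbF => yd; rewrite (phi'_old y) // => exy.
    by have := qU' _ (phi'_new _ xp); rewrite exy phiU.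
  + rewrite orbF in xd; rewrite (phi'_old x) // => exy.
    by have := qU' _ (phi'_new _ yp); rewrite -exy phiU.
  + rewrite orbF in xd; rewrite orbF => yd; by rewrite !phi'_old //; apply: phi_inj.
- move=> [i' j']; rewrite inE => /predU1P[[-> ->] /=|ijps'].
    move: pe; rewrite ep !rcons_cat !cat_path !path_rev_sym //; last exact: preserved_sym.
    rewrite !rcons_path => /and3P[e1 e2 e3].
    rewrite !walk_preserved ?m1 ?m2 ?phi'_old //=.
    rewrite preserved_sym /preserved esym e3 -(last_map phi') -[phi' (last _ p2)](last_map phi').
    by rewrite m1 m2 !phi'_old.
  have lt' := lt _ ijps'.
  apply: (@sub_in_path _ (mem (dom ps))) (phi_path _ ijps') => //=.
    by move=> u v /phi'_old eu /phi'_old ev; rewrite /preserved eu ev.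
  rewrite /= all_rcons; apply/and3P; split; [exact: b_dom|exact: b_dom|apply/allP=> x xp].
  suff : x \in dom ps by [].
  by rewrite inE; apply/orP; right; apply/hasP; exists (i', j').
- split=> //.
  + by move=> x; case: ifP => // _; rewrite -subnDA; apply: leq_trans (leq_subr _ _) (fD x).
  + move=> x; rewrite in_setU inE negb_or => /andP[xU /negbTE ->].
    rewrite -(fU _ xU); have [-> ->] : (x.1 == phi (b i)) = false /\ (x.1 == phi (b j)) = false.
      by split; apply: contraNF xU => /eqP ->; apply: phiU.
    by rewrite !subn0.
  (* A branch vertex loses a unit of demand exactly when the new pair is incident to it, and never
     two, as [b i] and [b j] differ. *)
  + move=> l c'; rewrite phi'_old //= ifN; last by apply: contraL (phiU _ (b_dom l)); apply: qU.
    have phiE m : (phi (b l) == phi (b m)) = (l == m).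
      by apply/eqP/eqP => [/phi_inj/b_inj ->|->].
    rewrite !phiE /incident /= ![_ == l]eq_sym; have := fb l c'.
    have : ~~ ((l == i) && (l == j)).
      by apply: contra bij => /andP[/eqP <- /eqP <-].
    by move: (f _) (count _ _); clear; case: (l == i); case: (l == j) => //= x n; lia.
- move=> x; rewrite dom_cons !in_setU ![_ \in [set:: _]]inE => /orP[xd|xp].
    by rewrite phi'_old // phiU.
  by rewrite -eq_q phi'_new ?orbT.
have cq : #|[set:: q1 ++ q2]| = size (p i j).
  by rewrite cardsE (card_uniqP uq) -sq !size_cat size_rev.
rewrite cdom addnA -cq; apply: leq_trans (leq_card_setU _ _) _.
by rewrite leq_add2r.
Qed.

Lemma embeddable_seq (ps : seq ('I_D * 'I_D)) : uniq ps ->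
  (forall ij, ij \in ps -> ij.1 < ij.2) -> embeddable ps.
Proof.
elim: ps => [|[i j] ps IH] /=; first by move=> _ _; apply: embeddable_nil.
move=> /andP[ijps ups] lt.
have lt_ps ij : ij \in ps -> ij.1 < ij.2 by move=> ijps'; apply: lt; rewrite inE ijps' orbT.
apply: embeddable_cons => //; last exact: IH.
by apply: (lt (i, j)); rewrite inE eqxx.
Qed.
End Embedding.

Theorem theorem1p4 (s t D : nat) (V W : finType)
  (G : 'I_t -> rel V) (e : rel W) (c : W -> W -> 'I_t) :
  1 <= s -> 1 <= t -> 3 <= D ->
  graph_family G -> s_joined G s ->
  edge_colored e c ->
  subdivision_KD e D (2 * up_log D.-1 s + 3) ->
  max_mon_deg_le e c D ->
  #|W| + 6 * s * D <= #|V| ->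
  contains G e c.
Proof.
move=> s_gt0 _ D_gt2 Gfam joined [[esym _] csym] [b [p [b_inj p_path p_disj cover edges]]] _ room.
have Gsym i : symmetric (G i) by have [] := Gfam i.
pose ps := [seq ij : 'I_D * 'I_D <- enum {: 'I_D * 'I_D} | ij.1 < ij.2].
have psP (i j : 'I_D) : i < j -> (i, j) \in ps by move=> ij; rewrite mem_filter ij mem_enum.
have [|ij|phi [_ [_ [phi_inj phi_path _ _ _]]]] :=
  embeddable_seq s_gt0 D_gt2 joined Gsym esym csym b_inj p_path p_disj room (ps := ps).
- by rewrite filter_uniq ?enum_uniq.
- by rewrite mem_filter => /andP[].
(* The branch vertices and paths cover the subdivision, so injectivity on [dom] is injectivity
   everywhere. *)
have domT x : x \in dom b p ps.
  rewrite inE; case: (cover x) => [[k ->]|[i [j [ij xp]]]]; first by rewrite codom_f.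
  by apply/orP; right; apply/hasP; exists (i, j); first exact: psP.
exists phi; split; first by move=> x y; apply: phi_inj.
move=> u v /edges[i [j [ij /=]]]; have /= pij := phi_path _ (psP i j ij).
case/orP=> /(path_zip pij) /andP[uv Guv] //.
by rewrite -csym // Gsym.
Qed.
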